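(* Let $G$ be a finite group and $N$ a normal subgroup of $G$. Suppose $\varphi:G\to H$ is an isomorphism of groups. Then \[\mathrm{dBIso}(\varphi)\circ\mathrm{dBInf}_{G/N}^G=\mathrm{dBInf}_{H/\varphi(N)}^H\circ\mathrm{dBIso}(\varphi'),\] as maps $B(G/N,G/N)^\times\to B(H,H)^\times$, where $\varphi':G/N\to H/\varphi(N)$ is the isomorphism induced by $\varphi$.
   Context: For finite groups $G,H$, a $(G,H)$-biset is a set with commuting left $G$-action and right $H$-action. $B(G,H)$ denotes the Grothendieck group of isomorphism classes of finite $(G,H)$-bisets with respect to disjoint union. For a $(G,H)$-biset $X$ and an $(H,K)$-biset $Y$, $X\times_H Y$ is the set of $H$-orbits of $X\times Y$ under $h\cdot(x,y)=(xh^{-1},hy)$, with its natural $(G,K)$-biset structure; this induces associative bilinear maps $\circ:B(G,H)\times B(H,K)\to B(G,K)$. The double Burnside ring of $G$ is $B(G,G)$ with multiplication $\circ$; its identity is $\mathrm{Id}_G=[G]$ ($G$ acting on itself by left and right multiplication). For $N\trianglelefteq G$, $\mathrm{Inf}_{G/N}^G\in B(G,G/N)$ is the class of the set $G/N$ with its natural $(G,G/N)$-action, and $\mathrm{Def}_{G/N}^G\in B(G/N,G)$ is the class of $G/N$ with its natural $(G/N,G)$-action. The group homomorphism $\mathrm{dBInf}_{G/N}^G:B(G/N,G/N)^\times\to B(G,G)^\times$ is $u\mapsto \mathrm{Id}_G+\mathrm{Inf}_{G/N}^G\circ(u-\mathrm{Id}_{G/N})\circ\mathrm{Def}_{G/N}^G$.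 For a group isomorphism $f:G\to H$, $\mathrm{Iso}(f)\in B(H,G)$ is the class of the set $H$ with the $(H,G)$-action $h\cdot x\cdot g=hxf(g)$, and $\mathrm{dBIso}(f):B(G,G)^\times\to B(H,H)^\times$ is the restriction to units of the ring isomorphism $B(G,G)\to B(H,H)$, $a\mapsto \mathrm{Iso}(f)\circ a\circ\mathrm{Iso}(f^{-1})$. *)

(* Defs.v *)
From HB Require Import structures.
From mathcomp Require Import all_boot all_order all_algebra all_fingroup.
From mathcomp Require Import generic_quotient boolp.

Set Implicit Arguments.
Unset Strict Implicit.
Unset Printing Implicit Defensive.

Import GRing.Theory GroupScope.
Local Open Scope quotient_scope.

Reserved Notation "x \oB y" (at level 40, left associativity).

Section Grothendieck.
Local Open Scope ring_scope.
Variable M : nmodType.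

(* The pair p stands for the formal difference p.1 - p.2.  The monoid M need  *)
(* not be cancellative, hence the k.                                          *)
Definition groth_rel (p q : M * M) : bool :=
  `[< exists k, p.1 + q.2 + k = q.1 + p.2 + k >].

Lemma groth_rel_refl : reflexive groth_rel.
Proof. by move=> p; apply/asboolP; exists 0. Qed.

Lemma groth_rel_sym : symmetric groth_rel.
Proof. by move=> p q; apply/asboolP/asboolP => -[k ek]; exists k. Qed.

Lemma groth_rel_trans : transitive groth_rel.
Proof.
move=> q p r /asboolP[k ek] /asboolP[l el]; apply/asboolP.
exists (k + l + q.1 + q.2); rewrite !addrA.
rewrite [LHS](ACl (1*6*3*(5*2*4)))/= ek el.
by rewrite [RHS](ACl (5*2*3*(1*6*4)))/=.
Qed.

Canonical groth_equiv :=
  EquivRel groth_rel groth_rel_refl groth_rel_sym groth_rel_trans.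

Definition groth := {eq_quot groth_rel}.
HB.instance Definition _ := Choice.on groth.
HB.instance Definition _ := EqQuotient.on groth.

Lemma groth_eqP (p q : M * M) :
  \pi_groth p = \pi_groth q <-> exists k, p.1 + q.2 + k = q.1 + p.2 + k.
Proof.
split; first by move/eqquotP => /asboolP.
by move=> h; apply/eqquotP/asboolP.
Qed.

Lemma groth_reprP (p : M * M) :
  exists k, (repr (\pi_groth p)).1 + p.2 + k = p.1 + (repr (\pi_groth p)).2 + k.
Proof. by apply/groth_eqP; rewrite reprK. Qed.

Lemma groth_piP (P : groth -> Prop) :
  (forall p, P (\pi_groth p)) -> forall x, P x.
Proof. by move=> h x; rewrite -[x]reprK. Qed.

Definition groth_of (m : M) : groth := \pi_groth (m, 0).
Definition groth_zero : groth := \pi_groth (0, 0).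
Definition groth_opp (x : groth) : groth :=
  \pi_groth ((repr x).2, (repr x).1).
Definition groth_add (x y : groth) : groth :=
  \pi_groth ((repr x).1 + (repr y).1, (repr x).2 + (repr y).2).

Lemma groth_addE (p q : M * M) :
  groth_add (\pi_groth p) (\pi_groth q) = \pi_groth (p.1 + q.1, p.2 + q.2).
Proof.
rewrite /groth_add; apply/groth_eqP => /=.
have [k ek] := groth_reprP p; have [l el] := groth_reprP q.
exists (k + l); rewrite !addrA.
rewrite [LHS](ACl (1*3*5*(2*4*6)))/= ek el !addrA.
by rewrite [RHS](ACl (1*3*5*2*4*6))/=.
Qed.

Lemma groth_oppE (p : M * M) :
  groth_opp (\pi_groth p) = \pi_groth (p.2, p.1).
Proof.
apply/groth_eqP => /=; have [k ek] := groth_reprP p.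
by exists k; rewrite [_ + p.1]addrC -ek [RHS](ACl (2*1*3))/=.
Qed.

Lemma groth_addA : associative groth_add.
Proof.
elim/groth_piP=> p; elim/groth_piP=> q; elim/groth_piP=> r.
rewrite (groth_addE q r) (groth_addE p q) (groth_addE p) (groth_addE _ r) /=.
by rewrite !addrA.
Qed.

Lemma groth_addC : commutative groth_add.
Proof.
elim/groth_piP=> p; elim/groth_piP=> q; rewrite !groth_addE.
by rewrite addrC [p.2 + _]addrC.
Qed.

Lemma groth_add0 : left_id groth_zero groth_add.
Proof. by elim/groth_piP=> -[m n]; rewrite groth_addE /= !add0r. Qed.

Lemma groth_addN : left_inverse groth_zero groth_opp groth_add.
Proof.
elim/groth_piP=> p; rewrite groth_oppE groth_addE /=.
by apply/groth_eqP; exists 0; rewrite /= !addr0 add0r addrC.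
Qed.

HB.instance Definition _ :=
  GRing.isZmodule.Build groth groth_addA groth_addC groth_add0 groth_addN.

Lemma groth_of0 : groth_of 0 = 0.
Proof. by []. Qed.

Lemma groth_ofD m n : groth_of (m + n) = groth_of m + groth_of n.
Proof.
by rewrite /GRing.add/= [RHS]groth_addE /= addr0.
Qed.

Lemma groth_of_eqP m n : groth_of m = groth_of n <-> exists k, m + k = n + k.
Proof.
rewrite groth_eqP /=.
by split=> -[k ek]; exists k; move: ek; rewrite !addr0.
Qed.

Lemma groth_piE p : \pi_groth p = groth_of p.1 - groth_of p.2.
Proof.
transitivity (groth_add (groth_of p.1) (groth_opp (groth_of p.2))) => //.
by rewrite groth_oppE groth_addE /= addr0 add0r; case: p.
Qed.

Lemma groth_ind (P : groth -> Prop) :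
  (forall m n, P (groth_of m - groth_of n)) -> forall x, P x.
Proof. by move=> h x; rewrite -[x]reprK groth_piE. Qed.

End Grothendieck.

(* The extension to groth M of an additive map f : M -> A.                    *)
HB.lock Definition groth_ext (M : nmodType) (A : zmodType) (f : M -> A)
  (x : groth M) : A := (f (repr x).1 - f (repr x).2)%R.
Canonical groth_ext_unlockable := Unlockable groth_ext.unlock.
Arguments groth_ext {M A} f x.

Section GrothExt.
Local Open Scope ring_scope.
Variables (M : nmodType) (A : zmodType) (f : M -> A).
Hypothesis fD : {morph f : m n / m + n}.

Lemma groth_extE m n : groth_ext f (groth_of m - groth_of n) = f m - f n.
Proof.
rewrite -(groth_piE (m, n)) unlock.
have [k /(congr1 f)] := groth_reprP (m, n); rewrite !fD /= => /addIr e.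
by apply/eqP; rewrite subr_eq addrAC eq_sym subr_eq -e addrC.
Qed.

Lemma groth_ext_of m : groth_ext f (groth_of m) = f m.
Proof.
have f0 : f 0 = 0 by apply: (@addIr _ (f 0)); rewrite -fD !add0r.
by rewrite -[groth_of m]subr0 -groth_of0 groth_extE f0 subr0.
Qed.

Lemma groth_extD : {morph groth_ext f : x y / x + y}.
Proof.
move=> x y; elim/groth_ind: x => a b; elim/groth_ind: y => c d.
rewrite addrACA -opprD -!groth_ofD !groth_extE !fD opprD.
by rewrite addrACA.
Qed.
End GrothExt.

Lemma zmorphB (A B : zmodType) (f : A -> B) :
  {morph f : x y / x + y}%R -> {morph f : x y / x - y}%R.
Proof.
move=> fD x y; apply: (@addIr _ (f y)).
by rewrite -fD !subrK.
Qed.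

Lemma groth_eqf (M : nmodType) (A : zmodType) (f g : groth M -> A) :
    {morph f : x y / x + y}%R -> {morph g : x y / x + y}%R ->
  (forall m, f (groth_of m) = g (groth_of m)) -> f =1 g.
Proof.
move=> fD gD e x; elim/groth_ind: x => m n.
by rewrite !zmorphB // !e.
Qed.

Section Biset.
Variables (gT hT : finGroupType) (G : {group gT}) (H : {group hT}).

(* The actions are total functions on the ambient types gT and hT; only their *)
(* values at elements of G and H are meaningful.                              *)
Record biset_on (X : finType) := BisetOn {
  lact : gT -> X -> X;
  ract : X -> hT -> X;
  lact1 : forall x, lact 1 x = x;
  lactM : {in G &, forall g g' x, lact (g * g') x = lact g (lact g' x)};
  ract1 : forall x, ract x 1 = x;
  ractM : {in H &, forall h h' x, ract x (h * h') = ract (ract x h) h'};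
  lractA : {in G & H, forall g h x, lact g (ract x h) = ract (lact g x) h}
}.

Record biset := Biset {
  biset_sort :> finType;
  biset_str : biset_on biset_sort
}.

Definition bl (X : biset) : gT -> X -> X := lact (biset_str X).
Definition br (X : biset) : X -> hT -> X := ract (biset_str X).

Definition biset_map (X Y : biset) (f : X -> Y) :=
  {in G, forall g x, f (bl g x) = bl g (f x)} /\
  {in H, forall h x, f (br x h) = br (f x) h}.

Definition biset_iso (X Y : biset) :=
  exists2 f : X -> Y, bijective f & biset_map f.

Lemma biset_iso_refl X : biset_iso X X.
Proof. by exists id; [exists id | split]. Qed.

Lemma biset_iso_sym X Y : biset_iso X Y -> biset_iso Y X.
Proof.
move=> [f [g fK gK] [fl fr]]; exists g; first by exists f.
by split=> a Aa x; rewrite -{1}[x]gK -?fl -?fr // fK.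
Qed.

Lemma biset_iso_trans X Y Z :
  biset_iso X Y -> biset_iso Y Z -> biset_iso X Z.
Proof.
move=> [f bf [fl fr]] [g bg [gl gr]]; exists (g \o f); first exact: bij_comp.
by split=> a Aa x /=; rewrite ?fl ?fr // ?gl ?gr.
Qed.

Section Sum.
Variables X Y : biset.
Definition sum_lact (g : gT) (z : X + Y) : X + Y :=
  match z with inl x => inl (bl g x) | inr y => inr (bl g y) end.
Definition sum_ract (z : X + Y) (h : hT) : X + Y :=
  match z with inl x => inl (br x h) | inr y => inr (br y h) end.
Fact sum_lact1 z : sum_lact 1 z = z.
Proof. by case: z => z /=; rewrite /bl lact1. Qed.
Fact sum_lactM : {in G &, forall g g' z,
  sum_lact (g * g') z = sum_lact g (sum_lact g' z)}.
Proof. by move=> g g' Gg Gg' [] z /=; rewrite /bl lactM. Qed.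
Fact sum_ract1 z : sum_ract z 1 = z.
Proof. by case: z => z /=; rewrite /br ract1. Qed.
Fact sum_ractM : {in H &, forall h h' z,
  sum_ract z (h * h') = sum_ract (sum_ract z h) h'}.
Proof. by move=> h h' Hh Hh' [] z /=; rewrite /br ractM. Qed.
Fact sum_lractA : {in G & H, forall g h z,
  sum_lact g (sum_ract z h) = sum_ract (sum_lact g z) h}.
Proof. by move=> g h Gg Hh [] z /=; rewrite /bl /br lractA. Qed.
Definition bsum : biset :=
  Biset (BisetOn sum_lact1 sum_lactM sum_ract1 sum_ractM sum_lractA).
End Sum.

Definition bempty : biset.
Proof. by exists void; exists (fun _ x => x) (fun x _ => x). Defined.

Lemma bsum_iso X X' Y Y' :
  biset_iso X X' -> biset_iso Y Y' -> biset_iso (bsum X Y) (bsum X' Y').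
Proof.
move=> [f [f' fK f'K] [fl fr]] [g [g' gK g'K] [gl gr]].
exists (fun z : bsum X Y =>
    match z with inl x => inl (f x) | inr y => inr (g y) end).
  exists (fun z : bsum X' Y' =>
    match z with inl x => inl (f' x) | inr y => inr (g' y) end).
  - by case=> z; rewrite ?fK ?gK.
  - by case=> z; rewrite ?f'K ?g'K.
by split=> a Aa [] z; congr (_ _); rewrite ?fl ?fr ?gl ?gr.
Qed.

Lemma bsumC X Y : biset_iso (bsum X Y) (bsum Y X).
Proof.
exists (fun z : bsum X Y => match z with inl x => inr x | inr y => inl y end).
  by exists (fun z : bsum Y X =>
    match z with inl x => inr x | inr y => inl y end); case.
by split=> a Aa [] z.
Qed.

Lemma bsumA X Y Z : biset_iso (bsum X (bsum Y Z)) (bsum (bsum X Y) Z).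
Proof.
exists (fun z : bsum X (bsum Y Z) => match z with
  inl x => inl (inl x) | inr (inl y) => inl (inr y) | inr (inr y) => inr y end).
  exists (fun z : bsum (bsum X Y) Z => match z with
  inl (inl x) => inl x | inl (inr y) => inr (inl y) | inr z => inr (inr z) end).
  - by case=> // -[].
  - by case=> // -[].
by split=> a Aa [|[]] z.
Qed.

Lemma bsum0 X : biset_iso (bsum bempty X) X.
Proof.
exists (fun z : bsum bempty X => match z with
  inl x => match x with end | inr x => x end).
  by exists (inr : X -> bsum bempty X) => // -[].
by split=> a Aa [] // [].
Qed.

Section Transport.
Variables (X : biset) (Y : finType) (f : X -> Y) (f' : Y -> X).
Hypotheses (fK : cancel f f') (f'K : cancel f' f).
Fact tr_lact1 y : f (bl 1 (f' y)) = y.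
Proof. by rewrite /bl lact1. Qed.
Fact tr_lactM : {in G &, forall g g' y,
  f (bl (g * g') (f' y)) = f (bl g (f' (f (bl g' (f' y)))))}.
Proof. by move=> g g' Gg Gg' y; rewrite fK /bl lactM. Qed.
Fact tr_ract1 y : f (br (f' y) 1) = y.
Proof. by rewrite /br ract1. Qed.
Fact tr_ractM : {in H &, forall h h' y,
  f (br (f' y) (h * h')) = f (br (f' (f (br (f' y) h))) h')}.
Proof. by move=> g g' Gg Gg' y; rewrite fK /br ractM. Qed.
Fact tr_lractA : {in G & H, forall g h y,
  f (bl g (f' (f (br (f' y) h)))) = f (br (f' (f (bl g (f' y)))) h)}.
Proof. by move=> g h Gg Hh y; rewrite !fK /bl /br lractA. Qed.
Definition btransport : biset_on Y := @BisetOn Y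
  (fun g y => f (bl g (f' y))) (fun y h => f (br (f' y) h))
  tr_lact1 tr_lactM tr_ract1 tr_ractM tr_lractA.
Lemma btransport_iso : biset_iso X (Biset btransport).
Proof.
exists (f : X -> Biset btransport); first by exists f'.
by split=> a Aa x; rewrite /bl /br /= fK.
Qed.
End Transport.

(* The bisets carried by some 'I_n represent all isomorphism classes, and     *)
(* unlike the bisets carried by arbitrary finite types they form a small type.*)
Definition obiset := {n : nat & biset_on 'I_n}.
HB.instance Definition _ := gen_eqMixin obiset.
HB.instance Definition _ := gen_choiceMixin obiset.

Definition biset_of (s : obiset) : biset := Biset (projT2 s).

Definition obiset_of (X : biset) : obiset :=
  existT _ #|X| (btransport (@enum_rankK X) (@enum_valK X)).

Lemma obiset_of_iso (X : biset) : biset_iso X (biset_of (obiset_of X)).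
Proof. exact: btransport_iso. Qed.

Definition obiset_rel (s t : obiset) : bool :=
  `[< biset_iso (biset_of s) (biset_of t) >].

Lemma obiset_rel_refl : reflexive obiset_rel.
Proof. by move=> s; apply/asboolP/biset_iso_refl. Qed.

Lemma obiset_rel_sym : symmetric obiset_rel.
Proof. by move=> s t; apply/asboolP/asboolP => /biset_iso_sym. Qed.

Lemma obiset_rel_trans : transitive obiset_rel.
Proof.
move=> t s u /asboolP st /asboolP tu; apply/asboolP.
exact: biset_iso_trans tu.
Qed.

Canonical obiset_equiv :=
  EquivRel obiset_rel obiset_rel_refl obiset_rel_sym obiset_rel_trans.

Definition bclass := {eq_quot obiset_rel}.
HB.instance Definition _ := Choice.on bclass.
HB.instance Definition _ := EqQuotient.on bclass.

Definition class_of (X : biset) : bclass := \pi_bclass (obiset_of X).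

Definition brepr (c : bclass) : biset := biset_of (repr c).

Lemma class_ofP X Y : class_of X = class_of Y <-> biset_iso X Y.
Proof.
have iX := obiset_of_iso X; have iY := obiset_of_iso Y.
split.
  move/eqquotP/asboolP => iXY; apply: biset_iso_trans iX _.
  by apply: biset_iso_trans iXY _; apply: biset_iso_sym.
move=> iXY; apply/eqquotP/asboolP.
apply: biset_iso_trans (biset_iso_sym iX) _.
exact: biset_iso_trans iXY iY.
Qed.

Lemma breprK c : class_of (brepr c) = c.
Proof.
rewrite -[RHS]reprK; apply/eqquotP/asboolP.
exact/biset_iso_sym/obiset_of_iso.
Qed.

Lemma brepr_class_of X : biset_iso (brepr (class_of X)) X.
Proof. by apply/class_ofP; rewrite breprK. Qed.

Definition bclass_add (c d : bclass) : bclass :=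
  class_of (bsum (brepr c) (brepr d)).

Lemma bclass_addE X Y :
  bclass_add (class_of X) (class_of Y) = class_of (bsum X Y).
Proof. by apply/class_ofP/bsum_iso; apply: brepr_class_of. Qed.

Lemma bclass_addA : associative bclass_add.
Proof.
move=> c d e; rewrite -[c]breprK -[d]breprK -[e]breprK !bclass_addE.
exact/class_ofP/bsumA.
Qed.

Lemma bclass_addC : commutative bclass_add.
Proof.
move=> c d; rewrite -[c]breprK -[d]breprK !bclass_addE.
exact/class_ofP/bsumC.
Qed.

Lemma bclass_add0 : left_id (class_of bempty) bclass_add.
Proof.
move=> c; rewrite -[c]breprK bclass_addE.
exact/class_ofP/bsum0.
Qed.

HB.instance Definition _ :=
  GRing.isNmodule.Build bclass bclass_addA bclass_addC bclass_add0.

Lemma class_ofD X Y : class_of (bsum X Y) = (class_of X + class_of Y)%R.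
Proof. by rewrite -bclass_addE. Qed.

Definition burnside := groth bclass.
HB.instance Definition _ := GRing.Zmodule.on burnside.

Definition bvirt (X : biset) : burnside := groth_of (class_of X).

Lemma bvirt_iso X Y : biset_iso X Y -> bvirt X = bvirt Y.
Proof. by rewrite /bvirt => /class_ofP ->. Qed.

End Biset.

Arguments bl {gT hT G H X} g x.
Arguments br {gT hT G H X} x h.

Section Tensor.
Variables (gT hT kT : finGroupType).
Variables (G : {group gT}) (H : {group hT}) (K : {group kT}).
Variables (X : biset G H) (Y : biset H K).
Implicit Types (x : X) (y : Y).

(* The H-orbit of p for h . (x, y) = (x h^-1, h y).                          *)
Definition torbit (p : X * Y) : {set X * Y} :=
  [set (br p.1 h^-1, bl h p.2) | h in H].

Definition torbits : {set {set X * Y}} := [set torbit p | p : X * Y].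

Definition tens_sort := {O : {set X * Y} | O \in torbits}.
HB.instance Definition _ := Finite.on tens_sort.

(* For g in G and k in K the image of an orbit is an orbit (tens_lactE and    *)
(* tens_ractE below), so that the default value of insubd is not used.        *)
Definition tens_lact (g : gT) (O : tens_sort) : tens_sort :=
  insubd O [set (bl g p.1, p.2) | p in val O].
Definition tens_ract (O : tens_sort) (k : kT) : tens_sort :=
  insubd O [set (p.1, br p.2 k) | p in val O].

Fact torbit_in p : torbit p \in torbits.
Proof. exact: imset_f. Qed.

Definition tpi x y : tens_sort := Sub (torbit (x, y)) (torbit_in (x, y)).

Lemma tpi_surj (O : tens_sort) : exists p, O = tpi p.1 p.2.
Proof.
case: O => O Oin; have /imsetP[[x y] _ defO] := Oin.
by exists (x, y); apply: val_inj.
Qed.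

Lemma tpi_ind (P : tens_sort -> Prop) :
  (forall x y, P (tpi x y)) -> forall O, P O.
Proof. by move=> h O; have [p ->] := tpi_surj O. Qed.

Lemma tpi_eqP x y x' y' :
  tpi x y = tpi x' y' <-> exists2 h, h \in H & x' = br x h^-1 /\ y' = bl h y.
Proof.
split.
  move/(congr1 val)/setP/(_ (x', y')) => /= e.
  have: (x', y') \in torbit (x', y').
    by apply/imsetP; exists 1; rewrite //= invg1 /br /bl ract1 lact1.
  by rewrite -e => /imsetP[h Hh [-> ->]]; exists h.
move=> [h Hh [-> ->]]; apply: val_inj => /=; apply/setP=> -[u v].
apply/imsetP/imsetP=> -[k Hk [-> ->]] /=.
  exists (k * h^-1); rewrite ?groupM ?groupV //= /br /bl.
  by rewrite -ractM -?lactM ?(groupM, groupV) // invgM invgK mulKg mulgKV.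
exists (k * h); rewrite ?groupM //= /br /bl.
by rewrite -ractM -?lactM ?(groupM, groupV) // invgM.
Qed.

Lemma tpiH h x y : h \in H -> tpi (br x h) y = tpi x (bl h y).
Proof.
move=> Hh; apply/tpi_eqP; exists h => //; split=> //.
by rewrite /br -ractM ?groupV // mulgV ract1.
Qed.

Lemma tens_lactE g x y : g \in G -> tens_lact g (tpi x y) = tpi (bl g x) y.
Proof.
move=> Gg; apply: val_inj; rewrite /tens_lact /=.
have e : [set (bl g p.1, p.2) | p in torbit (x, y)] = torbit (bl g x, y).
  rewrite /torbit -imset_comp; apply: eq_in_imset => h Hh /=.
  by rewrite /bl /br lractA ?groupV.
by rewrite e insubdK // torbit_in.
Qed.

Lemma tens_ractE k x y : k \in K -> tens_ract (tpi x y) k = tpi x (br y k).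
Proof.
move=> Kk; apply: val_inj; rewrite /tens_ract /=.
have e : [set (p.1, br p.2 k) | p in torbit (x, y)] = torbit (x, br y k).
  rewrite /torbit -imset_comp; apply: eq_in_imset => h Hh /=.
  by rewrite /bl /br lractA ?groupV.
by rewrite e insubdK // torbit_in.
Qed.

Fact tens_lact1 O : tens_lact 1 O = O.
Proof. by elim/tpi_ind: O => x y; rewrite tens_lactE // /bl lact1. Qed.
Fact tens_lactM : {in G &, forall g g' O,
  tens_lact (g * g') O = tens_lact g (tens_lact g' O)}.
Proof.
move=> g g' Gg Gg'; elim/tpi_ind=> x y.
by rewrite !tens_lactE ?groupM // /bl lactM.
Qed.
Fact tens_ract1 O : tens_ract O 1 = O.
Proof. by elim/tpi_ind: O => x y; rewrite tens_ractE // /br ract1. Qed.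
Fact tens_ractM : {in K &, forall k k' O,
  tens_ract O (k * k') = tens_ract (tens_ract O k) k'}.
Proof.
move=> k k' Kk Kk'; elim/tpi_ind=> x y.
by rewrite !tens_ractE ?groupM // /br ractM.
Qed.
Fact tens_lractA : {in G & K, forall g k O,
  tens_lact g (tens_ract O k) = tens_ract (tens_lact g O) k}.
Proof.
move=> g k Gg Kk; elim/tpi_ind=> x y.
by rewrite !(tens_lactE, tens_ractE).
Qed.

Definition tens : biset G K :=
  Biset (BisetOn tens_lact1 tens_lactM tens_ract1 tens_ractM tens_lractA).

Lemma bl_tpi g x y : g \in G -> bl g (tpi x y : tens) = tpi (bl g x) y.
Proof. exact: tens_lactE. Qed.

Lemma br_tpi k x y : k \in K -> br (tpi x y : tens) k = tpi x (br y k).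
Proof. exact: tens_ractE. Qed.

Lemma tpi_exists (O : tens_sort) : exists p, O == tpi p.1 p.2.
Proof. by have [p ->] := tpi_surj O; exists p. Qed.

Definition trep (O : tens_sort) : X * Y := xchoose (tpi_exists O).

Lemma trepK O : tpi (trep O).1 (trep O).2 = O.
Proof. exact/esym/eqP/(xchooseP (tpi_exists O)). Qed.

(* Maps out of X ×_H Y are given by H-balanced maps.                          *)
Section Ext.
Variables (Z : Type) (F : X -> Y -> Z).
Hypothesis FH : forall h x y, h \in H -> F (br x h) y = F x (bl h y).
Definition text (O : tens_sort) : Z := F (trep O).1 (trep O).2.
Lemma textE x y : text (tpi x y) = F x y.
Proof.
rewrite /text; move/tpi_eqP: (trepK (tpi x y)) => [h Hh].
case: (trep _) => u v /= [-> ->].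
by rewrite -FH // /br -ractM ?groupV // mulVg ract1.
Qed.
End Ext.

Lemma tens_isoP (Z : biset G K) (F : X -> Y -> Z) :
    (forall h x y, h \in H -> F (br x h) y = F x (bl h y)) ->
    (forall g x y, g \in G -> F (bl g x) y = bl g (F x y)) ->
    (forall k x y, k \in K -> F x (br y k) = br (F x y) k) ->
    (forall z, exists x y, F x y = z) ->
    (forall x y x' y', F x y = F x' y' -> tpi x y = tpi x' y') ->
  biset_iso tens Z.
Proof.
move=> FH FG FK Fsurj Finj; exists (text F : tens -> Z).
  have sF z : exists p, F p.1 p.2 == z.
    by have [x [y <-]] := Fsurj z; exists (x, y).
  pose r z := xchoose (sF z); have rP z : F (r z).1 (r z).2 = z.
    exact/eqP/(xchooseP (sF z)).
  exists (fun z => tpi (r z).1 (r z).2) => [O | z]; last by rewrite textE.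
  by elim/tpi_ind: O => x y; apply: Finj; rewrite rP textE.
split=> a Aa; elim/tpi_ind=> x y.
  by rewrite bl_tpi // !textE // FG.
by rewrite br_tpi // !textE // FK.
Qed.

End Tensor.

Section TensorIso.
Variables (gT hT kT lT : finGroupType).
Variables (G : {group gT}) (H : {group hT}) (K : {group kT}) (L : {group lT}).

Lemma tens_iso (X X' : biset G H) (Y Y' : biset H K) :
  biset_iso X X' -> biset_iso Y Y' -> biset_iso (tens X Y) (tens X' Y').
Proof.
move=> [f [f' fK f'K] [fl fr]] [u [u' uK u'K] [ul ur]].
apply: (@tens_isoP _ _ _ _ _ _ _ _ _ (fun x y => tpi (f x) (u y) : tens X' Y')).
- by move=> h x y Hh; rewrite fr // ul // tpiH.
- by move=> g x y Gg; rewrite fl // bl_tpi.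
- by move=> k x y Kk; rewrite ur // br_tpi.
- elim/tpi_ind=> x y; exists (f' x), (u' y).
  by rewrite f'K u'K.
move=> x y x' y' /tpi_eqP[h Hh [ex ey]]; apply/tpi_eqP; exists h => //.
split.
  by apply: (can_inj fK); rewrite ex fr ?groupV.
by apply: (can_inj uK); rewrite ey ul.
Qed.

Lemma tensA (X : biset G H) (Y : biset H K) (Z : biset K L) :
  biset_iso (tens (tens X Y) Z) (tens X (tens Y Z)).
Proof.
have bal z : forall h (x : X) (y : Y), h \in H ->
    tpi (br x h) (tpi y z : tens Y Z) = tpi x (tpi (bl h y) z : tens Y Z).
  by move=> h x y Hh; rewrite tpiH // bl_tpi.
pose F (t : tens X Y) (z : Z) : tens X (tens Y Z) :=
  text (fun x y => tpi x (tpi y z : tens Y Z)) t.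
have FE x y z : F (tpi x y) z = tpi x (tpi y z : tens Y Z).
  by apply: (@textE _ _ _ _ _ _ X Y _ _ (bal z)).
apply: (@tens_isoP _ _ _ _ _ _ _ _ _ F).
- move=> k + z Kk; elim/tpi_ind=> x y.
  by rewrite br_tpi // !FE tpiH.
- move=> g + z Gg; elim/tpi_ind=> x y.
  by rewrite bl_tpi // !FE bl_tpi.
- move=> l + z Ll; elim/tpi_ind=> x y.
  by rewrite !FE br_tpi // br_tpi.
- elim/tpi_ind=> x t; elim/tpi_ind: t => y z.
  by exists (tpi x y), z; rewrite FE.
elim/tpi_ind=> x y z; elim/tpi_ind=> x' y' z'; rewrite !FE.
move=> /tpi_eqP[h Hh [-> ]]; rewrite bl_tpi // => /esym/tpi_eqP[k Kk [-> ->]].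
apply/tpi_eqP; exists k => //; split=> //.
rewrite br_tpi ?groupV // tpiH ?groupV //.
by rewrite /bl /br -lractA ?groupV // -lactM ?groupV // mulVg lact1.
Qed.

Lemma tens_suml (X X' : biset G H) (Y : biset H K) :
  biset_iso (tens (bsum X X') Y) (bsum (tens X Y) (tens X' Y)).
Proof.
apply: (@tens_isoP _ _ _ _ _ _ _ _ _
  (fun (x : bsum X X') y => match x return bsum (tens X Y) (tens X' Y) with
     inl x => inl (tpi x y) | inr x => inr (tpi x y) end)).
- by move=> h [] x y Hh; congr (_ _); apply: tpiH.
- by move=> g [] x y Gg; congr (_ _); rewrite -bl_tpi.
- by move=> k [] x y Kk; congr (_ _); rewrite -br_tpi.
- case; elim/tpi_ind=> x y; first by exists (inl x), y.
  by exists (inr x), y.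
move=> [] x y [] x' y' // [] exy;
  (have /tpi_eqP[h Hh [-> ->]] : tpi x y = tpi x' y' by apply: val_inj);
  by apply/tpi_eqP; exists h.
Qed.

Lemma tens_sumr (X : biset G H) (Y Y' : biset H K) :
  biset_iso (tens X (bsum Y Y')) (bsum (tens X Y) (tens X Y')).
Proof.
apply: (@tens_isoP _ _ _ _ _ _ _ _ _
  (fun x (y : bsum Y Y') => match y return bsum (tens X Y) (tens X Y') with
     inl y => inl (tpi x y) | inr y => inr (tpi x y) end)).
- by move=> h x [] y Hh; congr (_ _); apply: tpiH.
- by move=> g x [] y Gg; congr (_ _); rewrite -bl_tpi.
- by move=> k x [] y Kk; congr (_ _); rewrite -br_tpi.
- case; elim/tpi_ind=> x y; first by exists x, (inl y).
  by exists x, (inr y).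
move=> x [] y x' [] y' // [] exy;
  (have /tpi_eqP[h Hh [-> ->]] : tpi x y = tpi x' y' by apply: val_inj);
  by apply/tpi_eqP; exists h.
Qed.

End TensorIso.

Section Composition.
Local Open Scope ring_scope.
Variables (gT hT kT : finGroupType).
Variables (G : {group gT}) (H : {group hT}) (K : {group kT}).

Definition bclass_comp (c : bclass G H) (d : bclass H K) : bclass G K :=
  class_of (tens (brepr c) (brepr d)).

Lemma bclass_compE X Y :
  bclass_comp (class_of X) (class_of Y) = class_of (tens X Y).
Proof. by apply/class_ofP/tens_iso; apply: brepr_class_of. Qed.

Lemma bclass_compDl d : {morph bclass_comp^~ d : c c' / c + c'}.
Proof.
move=> c c'; rewrite -[c]breprK -[c']breprK -[d]breprK -class_ofD.
by rewrite !bclass_compE -class_ofD; apply/class_ofP/tens_suml.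
Qed.

Lemma bclass_compDr c : {morph bclass_comp c : d d' / d + d'}.
Proof.
move=> d d'; rewrite -[c]breprK -[d]breprK -[d']breprK -class_ofD.
by rewrite !bclass_compE -class_ofD; apply/class_ofP/tens_sumr.
Qed.

(* The biadditive extension of (class_of X, class_of Y) |-> bvirt (tens X Y). *)
Definition bcomp (x : burnside G H) (y : burnside H K) : burnside G K :=
  groth_ext (fun c => groth_ext (fun d => groth_of (bclass_comp c d)) y) x.

Local Notation "x \oB y" := (bcomp x y) : ring_scope.

Let compD c : {morph (fun d => groth_of (bclass_comp c d)) : d d' / d + d'}.
Proof. by move=> d d'; rewrite bclass_compDr groth_ofD. Qed.

Let compDl (y : burnside H K) :
  {morph (fun c => groth_ext (fun d => groth_of (bclass_comp c d)) y) :
     c c' / c + c'}.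
Proof.
move=> c c' /=; elim/groth_ind: y => m n; rewrite !groth_extE //.
by rewrite !bclass_compDl !groth_ofD opprD addrACA.
Qed.

Lemma bcompDl x x' y : (x + x') \oB y = x \oB y + x' \oB y.
Proof. exact: groth_extD. Qed.

Lemma bcomp_of c d : groth_of c \oB groth_of d = groth_of (bclass_comp c d).
Proof. by rewrite /bcomp !groth_ext_of. Qed.

Lemma bcompDr x y y' : x \oB (y + y') = x \oB y + x \oB y'.
Proof.
rewrite /bcomp; elim/groth_ind: x => m n.
by rewrite !groth_extE // !groth_extD // opprD addrACA.
Qed.

Lemma bcomp_bvirt X Y : bvirt X \oB bvirt Y = bvirt (tens X Y).
Proof. by rewrite bcomp_of bclass_compE. Qed.

Lemma bcompBl x x' y : (x - x') \oB y = x \oB y - x' \oB y.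
Proof. by apply: (zmorphB (f := bcomp^~ y)) => ? ?; apply: bcompDl. Qed.

Lemma bcompBr x y y' : x \oB (y - y') = x \oB y - x \oB y'.
Proof. by apply: (zmorphB (f := bcomp x)) => ? ?; apply: bcompDr. Qed.

Lemma bcomp0l y : 0 \oB y = 0.
Proof. by have := bcompBl 0 0 y; rewrite !subrr. Qed.

Lemma bcomp0r x : x \oB 0 = 0.
Proof. by have := bcompBr x 0 0; rewrite !subrr. Qed.

End Composition.

Notation "x \oB y" := (bcomp x y) : ring_scope.

Lemma burnside_ind (gT hT : finGroupType) (G : {group gT}) (H : {group hT})
    (P : burnside G H -> Prop) :
  (forall X Y : biset G H, P (bvirt X - bvirt Y)%R) -> forall x, P x.
Proof.
move=> h; elim/groth_ind=> m n; rewrite -[m]breprK -[n]breprK.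
exact: h.
Qed.

Lemma burnside_eqf (gT hT : finGroupType) (G : {group gT}) (H : {group hT})
    (A : zmodType) (f g : burnside G H -> A) :
    {morph f : x y / x + y}%R -> {morph g : x y / x + y}%R ->
  (forall X, f (bvirt X) = g (bvirt X)) -> f =1 g.
Proof.
by move=> fD gD e; apply: groth_eqf => // m; rewrite -[m]breprK; apply: e.
Qed.

Lemma bcompA (gT hT kT lT : finGroupType) (G : {group gT}) (H : {group hT})
    (K : {group kT}) (L : {group lT})
    (x : burnside G H) (y : burnside H K) (z : burnside K L) :
  (x \oB (y \oB z) = x \oB y \oB z)%R.
Proof.
elim/burnside_ind: x => X X'; elim/burnside_ind: y => Y Y'.
elim/burnside_ind: z => Z Z'.
rewrite !(bcompBl, bcompBr) !bcomp_bvirt.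
have e U V W :
    bvirt (tens U (tens V W)) = bvirt (tens (tens U V) W) :> burnside G L.
  exact/bvirt_iso/biset_iso_sym/tensA.
by rewrite !e !opprD !opprK !addrA [LHS](ACl (1*3*5*7*2*4*6*8))%R.
Qed.

Definition hom_into (aT kT : finGroupType) (A : {group aT}) (K : {group kT})
    (a : aT -> kT) :=
  {in A &, {morph a : x y / x * y}} /\ {in A, forall x, a x \in K}.

Lemma hom_into1 (aT kT : finGroupType) (A : {group aT}) (K : {group kT})
  (a : aT -> kT) : hom_into A K a -> a 1 = 1.
Proof.
by move=> [aM _]; apply: (@mulgI _ (a 1)); rewrite -aM // !mulg1.
Qed.

Section HomBiset.
Variables (gT hT kT : finGroupType).
Variables (G : {group gT}) (H : {group hT}) (K : {group kT}).
Variables (a : gT -> kT) (b : hT -> kT).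
Hypotheses (aP : hom_into G K a) (bP : hom_into H K b).

(* The set K with g . x . h = a(g) x b(h).                                    *)
Definition hom_lact (g : gT) (x : subg_of K) : subg_of K := subg K (a g) * x.
Definition hom_ract (x : subg_of K) (h : hT) : subg_of K := x * subg K (b h).

Fact hom_lact1 x : hom_lact 1 x = x.
Proof.
rewrite /hom_lact (hom_into1 aP) [subg K 1](_ : _ = 1) ?mul1g //.
by apply: val_inj; rewrite /= subgK.
Qed.
Fact hom_lactM : {in G &, forall g g' x,
  hom_lact (g * g') x = hom_lact g (hom_lact g' x)}.
Proof.
move=> g g' Gg Gg' x; case: aP => aM aK.
by rewrite /hom_lact aM // subgM ?aK // mulgA.
Qed.
Fact hom_ract1 x : hom_ract x 1 = x.
Proof.
rewrite /hom_ract (hom_into1 bP) [subg K 1](_ : _ = 1) ?mulg1 //.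
by apply: val_inj; rewrite /= subgK.
Qed.
Fact hom_ractM : {in H &, forall h h' x,
  hom_ract x (h * h') = hom_ract (hom_ract x h) h'}.
Proof.
move=> h h' Hh Hh' x; case: bP => bM bK.
by rewrite /hom_ract bM // subgM ?bK // mulgA.
Qed.
Fact hom_lractA : {in G & H, forall g h x,
  hom_lact g (hom_ract x h) = hom_ract (hom_lact g x) h}.
Proof. by move=> g h _ _ x; rewrite /hom_lact /hom_ract mulgA. Qed.

Definition hom_biset : biset G H :=
  Biset (BisetOn hom_lact1 hom_lactM hom_ract1 hom_ractM hom_lractA).

End HomBiset.

Lemma hom_biset_comp (gT hT kT jT lT : finGroupType) (G : {group gT})
    (H : {group hT}) (J : {group jT}) (K : {group kT}) (L : {group lT})
    (a : gT -> kT) (b : hT -> kT) (c : hT -> lT) (d : jT -> lT) (e : lT -> kT)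
    (d' : jT -> kT) (aP : hom_into G K a) (bP : hom_into H K b)
    (cP : hom_into H L c) (dP : hom_into J L d) (d'P : hom_into J K d') :
    hom_into L K e ->
    {in L, forall y, exists2 h, h \in H & c h = y} ->
    {in H, forall h, e (c h) = b h} -> {in J, forall j, e (d j) = d' j} ->
  biset_iso (tens (hom_biset aP bP) (hom_biset cP dP)) (hom_biset aP d'P).
Proof.
move=> eP cL ec ed; case: (aP) => aM aK; case: (bP) => bM bK.
case: (cP) => cM cK; case: (dP) => dM dK; case: (eP) => eM eK.
case: (d'P) => d'M d'K.
have sM (T : finGroupType) (A : {group T}) (x y : subg_of A) :
  sgval (x * y) = sgval x * sgval y by [].
apply: (@tens_isoP _ _ _ _ _ _ (hom_biset aP bP) (hom_biset cP dP)
  (hom_biset aP d'P)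
  (fun (x : subg_of K) (y : subg_of L) => x * subg K (e (sgval y)))).
- move=> h x y Hh; rewrite /br /bl /= /hom_ract /hom_lact -mulgA; congr (_ * _).
  apply: val_inj; rewrite /= ?sM !subgK ?(eK, bK, cK, groupM) ?subgP //.
  by rewrite eM ?cK ?subgP // ec.
- by move=> g x y Gg; rewrite /bl /= /hom_lact mulgA.
- move=> j x y Jj; rewrite /br /= /hom_ract -mulgA; congr (_ * _).
  apply: val_inj; rewrite /= ?sM !subgK ?(eK, d'K, dK, groupM) ?subgP //.
  by rewrite eM ?dK ?subgP // ed.
- move=> z; exists z, (1 : subg_of L); rewrite [subg K _](_ : _ = 1) ?mulg1 //.
  by apply: val_inj; rewrite /= (hom_into1 eP) subgK.
move=> x y x' y' exy; apply/tpi_eqP.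
have [h Hh ch] := cL (sgval (y' * y^-1)) (subgP _).
exists h => //; split; apply: val_inj; rewrite /br /bl /= /hom_ract /hom_lact.
  have := congr1 (@sgval _ _) exy.
  rewrite !sM !subgK ?(eK, bK, groupV) ?subgP //.
  move=> exy'; have -> : b h^-1 = e (sgval y) * (e (sgval y'))^-1.
    have eV : {in L, forall u, e u^-1 = (e u)^-1}.
      move=> u Lu; apply: (@mulgI _ (e u)).
      by rewrite -eM ?groupV // !mulgV (hom_into1 eP).
    rewrite -eV ?subgP // -eM ?groupV ?subgP // -ec ?groupV //; congr (e _).
    have cV : c h^-1 = (c h)^-1.
      by apply: (@mulgI _ (c h)); rewrite -cM ?groupV // !mulgV (hom_into1 cP).
    by rewrite cV ch sM invgM /= invgK.
  by rewrite mulgA exy' mulgK.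
by rewrite /= subgK ?cK // ch /= mulgKV.
Qed.

Section Identity.
Variables (gT : finGroupType) (G : {group gT}).

Fact id_hom_into : hom_into G G id.
Proof. by split. Qed.

Definition id_biset : biset G G := hom_biset id_hom_into id_hom_into.

Definition bId : burnside G G := bvirt id_biset.

End Identity.

Section Unit.
Variables (gT hT : finGroupType) (G : {group gT}) (H : {group hT}).

Lemma tens_idl (X : biset G H) : biset_iso (tens (id_biset G) X) X.
Proof.
apply: (@tens_isoP _ _ _ _ _ _ (id_biset G) X X
  (fun (g : subg_of G) x => bl (sgval g) x)).
- move=> h g x Gh; rewrite /br /= /hom_ract /bl -lactM ?subgP //.
  by congr (lact _ _ _); rewrite /= subgK.
- move=> h g x Gh; rewrite /= {2}/bl /= /hom_lact /bl -lactM ?subgP //.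
  by congr (lact _ _ _); rewrite /= subgK.
- by move=> h g x Hh; rewrite /bl /br lractA ?subgP.
- by move=> x; exists (1 : subg_of G), x; rewrite /bl lact1.
move=> g x g' x' e; apply/tpi_eqP; exists (sgval (g'^-1 * g)).
  exact: subgP.
split.
  apply: val_inj; rewrite /br /= /hom_ract /= subgK ?(groupM, groupV, subgP) //.
  by rewrite invgM invgK mulgA mulgV mul1g.
rewrite /bl /= in e *; rewrite lactM ?groupV ?subgP // e.
by rewrite -lactM ?groupV ?subgP // mulVg lact1.
Qed.

Lemma tens_idr (X : biset G H) : biset_iso (tens X (id_biset H)) X.
Proof.
apply: (@tens_isoP _ _ _ _ _ _ X (id_biset H) X
  (fun x (h : subg_of H) => br x (sgval h))).
- move=> h x k Hh; rewrite /bl /= /hom_lact /br -ractM ?subgP //.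
  by congr (ract _ _ _); rewrite /= subgK.
- by move=> g x h Gg; rewrite /bl /br lractA ?subgP.
- move=> k x h Hk; rewrite /= {2}/br /= /hom_ract /br -ractM ?subgP //.
  by congr (ract _ _ _); rewrite /= subgK.
- by move=> x; exists x, (1 : subg_of H); rewrite /br ract1.
move=> x h x' h' e; apply/tpi_eqP; exists (sgval (h' * h^-1)).
  exact: subgP.
split.
  rewrite /br /= in e *; rewrite -[x'](ract1 (biset_str X)) -(mulgV (sgval h')).
  rewrite ractM ?groupV ?subgP // -e -ractM ?groupV ?subgP //.
  by rewrite invgM invgK.
apply: val_inj; rewrite /bl /= /hom_lact /= subgK ?(groupM, groupV, subgP) //.
by rewrite mulgKV.
Qed.

Lemma bcomp1l (x : burnside G H) : (bId G \oB x = x)%R.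
Proof.
elim/burnside_ind: x => X Y; rewrite bcompBr !bcomp_bvirt.
by congr (_ - _)%R; apply/bvirt_iso/tens_idl.
Qed.

Lemma bcomp1r (x : burnside G H) : (x \oB bId H = x)%R.
Proof.
elim/burnside_ind: x => X Y; rewrite bcompBl !bcomp_bvirt.
by congr (_ - _)%R; apply/bvirt_iso/tens_idr.
Qed.

End Unit.

Section DoubleBurnside.
Local Open Scope ring_scope.
Variables (gT : finGroupType) (G : {group gT}).

Lemma bId_neq0 : bId G != 0.
Proof.
apply/eqP => /groth_of_eqP[k]; rewrite add0r -[k]breprK -class_ofD.
move=> /class_ofP[f /bij_eq_card]; rewrite card_sum => /eqP.
rewrite -[X in _ == X]add0n eqn_add2r => /eqP/card0_eq/(_ (1%g : subg_of G)).
by [].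
Qed.

HB.instance Definition _ := GRing.Zmodule_isNzRing.Build (burnside G G)
  (@bcompA _ _ _ _ G G G G) (@bcomp1l _ _ G G) (@bcomp1r _ _ G G)
  (@bcompDl _ _ _ G G G) (@bcompDr _ _ _ G G G) bId_neq0.

Let has_inv (x : burnside G G) := exists y, y * x = 1 /\ x * y = 1.

Definition burnside_inv (x : burnside G G) : burnside G G :=
  if pselect (has_inv x) is left ex then projT1 (cid ex) else x.

Let unitb (x : burnside G G) := `[< has_inv x >].

Fact burnside_mulVx : {in unitb, left_inverse 1 burnside_inv *%R}.
Proof.
move=> x /asboolP ux; rewrite /burnside_inv; case: pselect => // ex.
by case: cid => y [].
Qed.
Fact burnside_mulxV : {in unitb, right_inverse 1 burnside_inv *%R}.
Proof.
move=> x /asboolP ux; rewrite /burnside_inv; case: pselect => // ex.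
by case: cid => y [].
Qed.
Fact burnside_unitP x y : y * x = 1 /\ x * y = 1 -> x \in unitb.
Proof. by move=> xy; apply/asboolP; exists y. Qed.
Fact burnside_inv_out : {in [predC unitb], burnside_inv =1 id}.
Proof.
move=> x /asboolP ux; rewrite /burnside_inv.
by case: pselect.
Qed.

HB.instance Definition _ := GRing.NzRing_hasMulInverse.Build (burnside G G)
  burnside_mulVx burnside_mulxV burnside_unitP burnside_inv_out.

Lemma burnside_unitrP (x y : burnside G G) :
  x \oB y = bId G -> y \oB x = bId G -> x \is a GRing.unit.
Proof. by move=> xy yx; apply/unitrP; exists y. Qed.

Definition burnside_units := {u : burnside G G | u \is a GRing.unit}.

End DoubleBurnside.

Section InfDef.
Variables (gT : finGroupType) (G N : {group gT}) (nNG : N <| G).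

Fact coset_hom_into : hom_into G (G / N)%G (coset N).
Proof.
have nG := subsetP (normal_norm nNG).
split=> [x y Gx Gy | x Gx]; first by rewrite morphM ?nG.
exact: mem_quotient.
Qed.

Definition bInf : burnside G (G / N)%G :=
  bvirt (hom_biset coset_hom_into (id_hom_into (G / N)%G)).
Definition bDef : burnside (G / N)%G G :=
  bvirt (hom_biset (id_hom_into (G / N)%G) coset_hom_into).

Local Open Scope ring_scope.

Lemma bDef_bInf : bDef \oB bInf = bId (G / N)%G.
Proof.
rewrite bcomp_bvirt; apply: bvirt_iso.
apply: (hom_biset_comp (e := id)) => //.
- exact: id_hom_into.
- by move=> y /morphimP[x _ Gx ->]; exists x.
Qed.

Definition dBInf_val (x : burnside (G / N)%G (G / N)%G) : burnside G G :=
  bId G + bInf \oB (x - bId (G / N)%G) \oB bDef.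

Lemma dBInf_val1 : dBInf_val (bId _) = bId G.
Proof.
by rewrite /dBInf_val subrr bcomp0r bcomp0l addr0.
Qed.

Lemma dBInf_valM x y :
  dBInf_val (x \oB y) = dBInf_val x \oB dBInf_val y.
Proof.
rewrite /dBInf_val bcompDl bcomp1l -!addrA; congr (_ + _).
set w := _ - bId _; set u := x - _; set v := y - _.
rewrite bcompDr bcomp1r.
have -> : bInf \oB u \oB bDef \oB (bInf \oB v \oB bDef) =
          bInf \oB (u \oB v) \oB bDef.
  rewrite !bcompA -[_ \oB bDef \oB bInf]bcompA bDef_bInf bcomp1r.
  by rewrite -[_ \oB u \oB v]bcompA.
rewrite -!bcompDl -!bcompDr; congr (_ \oB _ \oB _).
rewrite /w /u /v bcompBl !bcompBr !bcomp1l bcomp1r.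
by rewrite [RHS]addrC -[RHS]addrA subrK [RHS]addrC addrA subrK.
Qed.

Fact dBInf_unit (u : burnside_units (G / N)%G) :
  dBInf_val (val u) \is a GRing.unit.
Proof.
case: u => u /= /unitrP[v [vu uv]].
by apply: (@burnside_unitrP _ _ _ (dBInf_val v));
   rewrite -dBInf_valM -dBInf_val1; congr dBInf_val.
Qed.

Definition dBInf (u : burnside_units (G / N)%G) : burnside_units G :=
  Sub (dBInf_val (val u)) (dBInf_unit u).

End InfDef.

Section Iso.
Variables (gT hT : finGroupType) (G : {group gT}) (H : {group hT}).
Variables (f : {morphism G >-> hT}) (isof : isom G H f).

Fact isom_hom_into : hom_into G H f.
Proof.
split=> [x y Gx Gy | x Gx]; first by rewrite morphM.
by rewrite -(isom_im isof) mem_morphim.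
Qed.

Definition bIso : burnside H G :=
  bvirt (hom_biset (id_hom_into H) isom_hom_into).

End Iso.

Lemma bIso_comp1 (gT hT : finGroupType) (G : {group gT}) (H : {group hT})
    (f : {morphism G >-> hT}) (g : {morphism H >-> gT})
    (isof : isom G H f) (isog : isom H G g) :
  {in H, cancel g f} -> (bIso isof \oB bIso isog = bId H)%R.
Proof.
move=> gK; rewrite bcomp_bvirt; apply: bvirt_iso.
apply: (hom_biset_comp (e := f)) => //.
  exact: isom_hom_into.
by move=> y Gy; exists y.
Qed.

Section DBIso.
Local Open Scope ring_scope.
Variables (gT hT : finGroupType) (G : {group gT}) (H : {group hT}).
Variables (f : {morphism G >-> hT}) (isof : isom G H f).

Lemma bIsoV : bIso isof \oB bIso (isom_sym isof) = bId H.
Proof.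
apply: bIso_comp1 => y; rewrite -{1}(isom_im isof) => fGy.
exact: invmK.
Qed.

Lemma bVIso : bIso (isom_sym isof) \oB bIso isof = bId G.
Proof. by apply: bIso_comp1 => x Gx; apply: invmE. Qed.

Definition dBIso_val (x : burnside G G) : burnside H H :=
  bIso isof \oB x \oB bIso (isom_sym isof).

Lemma dBIso_val1 : dBIso_val (bId G) = bId H.
Proof. by rewrite /dBIso_val bcomp1r bIsoV. Qed.

Lemma dBIso_valM x y : dBIso_val (x \oB y) = dBIso_val x \oB dBIso_val y.
Proof.
rewrite /dBIso_val !bcompA -[_ \oB _ \oB bIso isof]bcompA bVIso bcomp1r.
by [].
Qed.

Fact dBIso_unit (u : burnside_units G) : dBIso_val (val u) \is a GRing.unit.
Proof.
case: u => u /= /unitrP[v [vu uv]].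
by apply: (@burnside_unitrP _ _ _ (dBIso_val v));
   rewrite -dBIso_valM -dBIso_val1; congr dBIso_val.
Qed.

Definition dBIso (u : burnside_units G) : burnside_units H :=
  Sub (dBIso_val (val u)) (dBIso_unit u).

End DBIso.

Section InducedIso.
Variables (gT hT : finGroupType) (G N : {group gT}) (H : {group hT}).
Variables (nNG : N <| G) (f : {morphism G >-> hT}) (isof : isom G H f).

Lemma isom_normal : (f @* N)%G <| H.
Proof. by rewrite -(isom_im isof) morphim_normal. Qed.

Lemma quotm_isom : isom (G / N)%G (H / (f @* N))%G (quotm f nNG).
Proof.
apply/isomP; split; first by apply/injm_quotm/(isom_inj isof).
by rewrite morphim_quotm (isom_im isof).
Qed.

End InducedIso.

(* Main.v *)
Require Import Defs.
From mathcomp Require Import all_boot all_order all_algebra all_fingroup.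

Local Open Scope group_scope.

(** Write [I] for [Iso(phi)] and [I'] for [Iso(phi')].  Everything follows from
    the two naturality relations
      [I o Inf_{G/N} = Inf_{H/phi(N)} o I'] ([bIso_bInf]) and
      [Def_{H/phi(N)} o I = I' o Def_{G/N}] ([bDef_bIso]).
    Composing the second with the inverse isomorphisms turns it into
    [Def_{G/N} o I^-1 = I'^-1 o Def_{H/phi(N)}], whence
      [I o (Id + Inf o (u - Id) o Def) o I^-1
         = Id + Inf o I' o (u - Id) o I'^-1 o Def]
    and [I' o (u - Id) o I'^-1 = I' o u o I'^-1 - Id]: this is the claim.

    In each relation both sides are the class of one biset carried by the group
    [H / phi(N)], with actions through the commutative square formed by [phi],
    [phi'] and the two projections.  Each composite is a tensor product over a
    group [A] of two groups [K] and [L] receiving homomorphisms from [A].  When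
    [A] maps onto [L] and [A -> K] factors through [L], the product is [K], by
    [hom_biset_comp]; this applies to three of the composites.  It does
    not cover [I o Inf_{G/N} = H x_G G/N], since [phi] does not factor through
    [G/N] unless [N] is trivial; [hom_biset_tens_iso] replaces it: what matters
    is that [A] maps onto the fibre product of [K] and [L] over the expected
    value, and here this follows from the injectivity of [phi']. *)

(** Two pairs [(x, y)] and [(x', y')] have the same image [e1 x * e2 y] exactly
    when [x'^-1 * x] and [y' * y^-1] have the same image in [M]; an [h] in [H]
    lifting this point of the fibre product of [K] and [L] over [M] then
    carries the first pair to the second. *)
Lemma hom_biset_tens_iso {gT hT kT jT lT mT : finGroupType} {G : {group gT}}
    {H : {group hT}} {J : {group jT}} {K : {group kT}} {L : {group lT}}
    {M : {group mT}} {a : gT -> kT} {b : hT -> kT} {c : hT -> lT}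
    {d : jT -> lT} {e1 : kT -> mT} {e2 : lT -> mT} {a' : gT -> mT}
    {d' : jT -> mT} {aP : hom_into G K a} {bP : hom_into H K b}
    {cP : hom_into H L c} {dP : hom_into J L d}
    {a'P : hom_into G M a'} {d'P : hom_into J M d'} :
    hom_into K M e1 -> hom_into L M e2 ->
    {in G, forall g, e1 (a g) = a' g} -> {in J, forall j, e2 (d j) = d' j} ->
    {in H, forall h, e1 (b h) = e2 (c h)} ->
    {in M, forall z, exists2 x, x \in K & e1 x = z} ->
    {in K & L, forall x y, e1 x = e2 y ->
       exists h, [/\ h \in H, b h = x & c h = y]} ->
  biset_iso (tens (hom_biset aP bP) (hom_biset cP dP)) (hom_biset a'P d'P).
Proof.
move=> e1P e2P e1a e2d e1b_e2c e1_surj lift_fibre.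
have [[_ aK] [bM bK] [cM cK]] := And3 aP bP cP.
have [[_ dL] [_ a'M] [_ d'M]] := And3 dP a'P d'P.
have [[e1M e1K] [e2M e2L]] := conj e1P e2P.
have sM (T : finGroupType) (A : {group T}) (x y : subg_of A) :
  sgval (x * y) = sgval x * sgval y by [].
have e1V x : x \in K -> e1 x^-1 = (e1 x)^-1.
  move=> Kx; apply: (@mulgI _ (e1 x)).
  by rewrite -e1M ?groupV // !mulgV (hom_into1 e1P).
have e2V y : y \in L -> e2 y^-1 = (e2 y)^-1.
  move=> Ly; apply: (@mulgI _ (e2 y)).
  by rewrite -e2M ?groupV // !mulgV (hom_into1 e2P).
have bV h : h \in H -> b h^-1 = (b h)^-1.
  move=> Hh; apply: (@mulgI _ (b h)).
  by rewrite -bM ?groupV // !mulgV (hom_into1 bP).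
apply: (@tens_isoP _ _ _ _ _ _ (hom_biset aP bP) (hom_biset cP dP)
  (hom_biset a'P d'P) (fun (x : subg_of K) (y : subg_of L) =>
     subg M (e1 (sgval x)) * subg M (e2 (sgval y)))).
- move=> h x y Hh; rewrite /br /bl /= /hom_ract /hom_lact; apply: subg_inj.
  rewrite !sM !subgK ?(e1K, e2L, bK, cK, groupM) ?subgP //.
  by rewrite e1M ?e2M ?(bK, cK) ?subgP // e1b_e2c // mulgA.
- move=> g x y Gg; rewrite /bl /= /hom_lact mulgA; congr (_ * _).
  apply: subg_inj; rewrite !sM !subgK ?(e1K, a'M, aK, groupM) ?subgP //.
  by rewrite e1M ?aK ?subgP // e1a.
- move=> j x y Jj; rewrite /br /= /hom_ract -mulgA; congr (_ * _).
  apply: subg_inj; rewrite !sM !subgK ?(e2L, d'M, dL, groupM) ?subgP //.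
  by rewrite e2M ?dL ?subgP // e2d.
- move=> z; have [x Kx e1x] := e1_surj _ (subgP z).
  exists (subg K x), (1 : subg_of L); apply: subg_inj.
  by rewrite sM /= (hom_into1 e2P) !subgK ?(e1K, group1) // mulg1.
move=> x y x' y' /(congr1 (@sgval _ _)).
rewrite !sM !subgK ?(e1K, e2L) ?subgP // => exy; apply/tpi_eqP.
have [|||h [Hh bh ch]] :=
    lift_fibre (sgval (x'^-1 * x)) (sgval (y' * y^-1)).
- exact: subgP.
- exact: subgP.
- rewrite !sM /= e1M ?groupV ?subgP // e2M ?groupV ?subgP //.
  rewrite e1V ?e2V ?subgP //; apply: (canRL (mulgK _)).
  by rewrite -mulgA exy mulKg.
exists h => //; split; apply: subg_inj; rewrite /br /bl /= /hom_ract /hom_lact.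
  by rewrite subgK ?bK ?groupV // bV // bh sM invgM /= invgK mulKVg.
by rewrite subgK ?cK // ch sM /= mulgKV.
Qed.

Section Naturality.
Local Open Scope ring_scope.
Variables (gT hT : finGroupType) (G N : {group gT}) (H : {group hT}).
Variables (nNG : N <| G) (phi : {morphism G >-> hT}) (isophi : isom G H phi).

Let nNH := isom_normal nNG isophi.
Let isophi' := quotm_isom nNG isophi.

Lemma bIso_bInf :
  bIso isophi \oB bInf nNG = bInf nNH \oB bIso isophi'.
Proof.
rewrite !bcomp_bvirt; apply: bvirt_iso.
apply: (@biset_iso_trans _ _ _ _ _
  (hom_biset (coset_hom_into nNH) (isom_hom_into isophi'))).
  apply: (hom_biset_tens_iso (e1 := coset (phi @* N)%G)
                             (e2 := quotm phi nNG)) => //.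
  - exact: coset_hom_into.
  - exact: isom_hom_into.
  - by move=> g Gg; rewrite /= quotmE.
  - by move=> z /morphimP[x _ Hx ->]; exists x.
  move=> x y Hx GNy /= exy.
  have [g Gg phig] : exists2 g, g \in G & phi g = x.
    by move: Hx; rewrite -(isom_im isophi) => /morphimP[g _ Gg ->]; exists g.
  exists g; split=> //; apply: (injmP (isom_inj isophi')) => //.
    exact: mem_quotient.
  by rewrite /= quotmE // phig.
apply: biset_iso_sym; apply: (hom_biset_comp (e := id)) => //.
- exact: id_hom_into.
- by move=> y Hy; exists y.
Qed.

Lemma bDef_bIso :
  bDef nNH \oB bIso isophi = bIso isophi' \oB bDef nNG.
Proof.
have dP : hom_into G (H / (phi @* N))%G (quotm phi nNG \o coset N).
  have [cM cG] := coset_hom_into nNG; have [qM qG] := isom_hom_into isophi'.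
  split=> [x y Gx Gy | x Gx] /=; last by rewrite qG ?cG.
  by rewrite cM // qM ?cG.
rewrite !bcomp_bvirt; apply: bvirt_iso.
apply: (@biset_iso_trans _ _ _ _ _ (hom_biset (id_hom_into _) dP)).
  apply: (hom_biset_comp (e := coset (phi @* N)%G)) => //.
  - exact: coset_hom_into.
  - by move=> y Hy; exists y.
  - by move=> g Gg; rewrite /= quotmE.
apply: biset_iso_sym; apply: (hom_biset_comp (e := quotm phi nNG)) => //.
- exact: isom_hom_into.
- by move=> y Hy; exists y.
Qed.

(** Composing [bDef_bIso] with the inverse isomorphism on either side avoids any
    computation with the inverse of [phi]. *)
Lemma bDef_bIsoV :
  bDef nNG \oB bIso (isom_sym isophi) = bIso (isom_sym isophi') \oB bDef nNH.
Proof.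
rewrite -[bDef nNH]bcomp1r -(bIsoV isophi) !bcompA.
by rewrite -[_ \oB bDef nNH \oB _]bcompA bDef_bIso bcompA bVIso bcomp1l.
Qed.

End Naturality.

Theorem proposition3p7 (gT hT : finGroupType) (G N : {group gT})
    (H : {group hT}) (nNG : N <| G) (phi : {morphism G >-> hT})
    (isophi : isom G H phi) :
  dBIso isophi \o dBInf nNG =1
    dBInf (isom_normal nNG isophi) \o dBIso (quotm_isom nNG isophi).
Proof.
move=> u; apply: val_inj; rewrite /= /dBIso_val /dBInf_val.
(* Write Id_{H/phi(N)} as the conjugate of Id_{G/N} to factor out u - Id. *)
rewrite -(dBIso_val1 (quotm_isom nNG isophi)) /dBIso_val -bcompBl -bcompBr.
rewrite bcompDr bcompDl bcomp1r bIsoV; congr (_ + _)%R.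
by rewrite !bcompA bIso_bInf -!bcompA bDef_bIsoV.
Qed.
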